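(* Let $(X, d_X)$, $(Y, d_Y)$ be metric spaces. For any real $\varepsilon > 2\, \mathrm{d_{GH}}(X,Y)$, the persistence modules $\mathrm{H}(\check{\mathbb{C}}\mathrm{ech}(X))$ and $\mathrm{H}(\check{\mathbb{C}}\mathrm{ech}(Y))$ are $\varepsilon$-interleaved.
   Context: Fix a field $\mathbf{k}$; $\mathrm{H}$ denotes (total) simplicial homology with coefficients in $\mathbf{k}$. A persistence module $\mathbb{V}$ is a family of $\mathbf{k}$-vector spaces $(V_a)_{a\in\mathbf{R}}$ with linear maps $v_a^b:V_a\to V_b$ for $a\le b$ such that $v_a^a=\mathrm{id}$ and $v_b^c\circ v_a^b=v_a^c$ for $a\le b\le c$. A homomorphism of degree $\varepsilon$, $\Phi\in\mathrm{Hom}^\varepsilon(\mathbb{U},\mathbb{V})$, is a family of linear maps $(\phi_a:U_a\to V_{a+\varepsilon})_{a\in\mathbf{R}}$ with $v_{a+\varepsilon}^{b+\varepsilon}\circ\phi_a=\phi_b\circ u_a^b$ for all $a\le b$. $\mathbb{U},\mathbb{V}$ are $\varepsilon$-interleaved if there are $\Phi\in\mathrm{Hom}^\varepsilon(\mathbb{U},\mathbb{V})$, $\Psi\in\mathrm{Hom}^\varepsilon(\mathbb{V},\mathbb{U})$ with $\psi_{a+\varepsilon}\circ\phi_a=u_a^{a+2\varepsilon}$ and $\phi_{a+\varepsilon}\circ\psi_a=v_a^{a+2\varepsilon}$ for all $a$. A correspondence $C:X\rightrightarrows Y$ is a subset of $X\times Y$ projecting surjectively onto both $X$ and $Y$;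 its distortion is $\mathrm{dis}(C)=\sup\{|d_X(x,x')-d_Y(y,y')| : (x,y),(x',y')\in C\}$ (with $\sup\emptyset=0$). The Gromov--Hausdorff distance is $\mathrm{d_{GH}}(X,Y)=\frac12\inf\{\mathrm{dis}(C): C \text{ a correspondence } X\rightrightarrows Y\}\in[0,+\infty]$. For a metric space $(X,d_X)$ and $a\in\mathbf{R}$, the intrinsic Čech complex $\check{\mathrm{C}}\mathrm{ech}(X,a)$ is the simplicial complex whose simplices are the nonempty finite subsets $\{x_0,\dots,x_k\}\subseteq X$ with $\bigcap_{i=0}^k B(x_i,a)\neq\emptyset$, where $B(x,a)=\{x'\in X: d_X(x,x')\le a\}$ (so it is empty for $a<0$). $\check{\mathbb{C}}\mathrm{ech}(X)$ is the filtered complex $(\check{\mathrm{C}}\mathrm{ech}(X,a))_{a\in\mathbf{R}}$, and $\mathrm{H}(\check{\mathbb{C}}\mathrm{ech}(X))$ is the persistence module $(\mathrm{H}(\check{\mathrm{C}}\mathrm{ech}(X,a)))_{a}$ with maps induced by inclusions. *)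

(* Defs.v *)
From HB Require Import structures.
From mathcomp Require Import all_boot all_order all_algebra finmap.
From mathcomp Require Import all_classical all_reals ereal topology.
From mathcomp Require Import freeg.

Set Implicit Arguments.
Unset Strict Implicit.
Unset Printing Implicit Defensive.

Import Order.TTheory GRing.Theory Num.Theory.

Local Open Scope quotient_scope.
Local Open Scope classical_set_scope.
Local Open Scope ring_scope.

Section LinearSpan.
Context (k : fieldType) (V : lmodType k) (G : set V).

Definition lspan : {pred V} := fun v => `[<
  exists s : seq (k * V),
    (forall p, p \in s -> G p.2) /\ v = \sum_(p <- s) p.1 *: p.2 >].

Lemma lspan_submod_closed : subsemimod_closed lspan.
Proof.
split; first split.
- by apply/asboolP; exists [::]; rewrite big_nil.
- move=> u v /asboolP[s [sG ->]] /asboolP[t [tG ->]].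
  apply/asboolP; exists (s ++ t); rewrite big_cat; split=> // p.
  by rewrite mem_cat => /orP[/sG|/tG].
- move=> a v /asboolP[s [sG ->]]; apply/asboolP.
  exists [seq (a * p.1, p.2) | p <- s]; split.
    by move=> p /mapP[q /sG ? ->].
  by rewrite big_map scaler_sumr; apply: eq_bigr => p _; rewrite scalerA.
Qed.

HB.instance Definition _ :=
  GRing.isSubmodClosed.Build k V lspan lspan_submod_closed.

Lemma lspan_ind_eq0 (U : lmodType k) (f : {linear V -> U}) :
  (forall g, G g -> f g = 0) -> forall v, v \in lspan -> f v = 0.
Proof.
move=> fG v /asboolP[s [sG ->]]; rewrite linear_sum big_seq big1// => p ps.
by rewrite linearZ /= fG ?scaler0//; exact: sG.
Qed.

Lemma mem_lspan g : G g -> g \in lspan.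
Proof.
move=> Gg; apply/asboolP; exists [:: (1, g)]; rewrite big_seq1 scale1r.
by split=> // p; rewrite inE => /eqP ->.
Qed.

End LinearSpan.

Section Submodule.
Context (k : fieldType) (V : lmodType k) (W : submodClosed V).

Definition submodule : Type := {v : V | v \in W}.

HB.instance Definition _ := [isSub of submodule for @sval _ _].
HB.instance Definition _ := [Choice of submodule by <:].
HB.instance Definition _ := [SubChoice_isSubLmodule of submodule by <:].

End Submodule.

Section QuotientModule.
Context (k : fieldType) (V : lmodType k) (W : submodClosed V).

Let W_zmod_closed : zmod_closed W.
Proof. exact/GRing.submod_closedB/submodClosedP. Qed.

Definition submod_zmodClosed : zmodClosed V :=
  HB.pack (GRing.SubmodClosed.sort W)
    (GRing.isZmodClosed.Build V _ W_zmod_closed).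

Definition quotmod : Type := Quotient.quot submod_zmodClosed.

HB.instance Definition _ := GRing.Zmodule.on quotmod.
HB.instance Definition _ := Quotient.on quotmod.

Definition qpi (v : V) : quotmod := \pi_(Quotient.quot submod_zmodClosed) v.
Definition qscale (a : k) (x : quotmod) : quotmod := qpi (a *: repr x).

Lemma qpi_eq u v : qpi u = qpi v <-> u - v \in W.
Proof.
rewrite /qpi; split=> [|uv]; first by move/eqP; rewrite -Quotient.idealrBE.
by apply/eqP; rewrite -Quotient.idealrBE.
Qed.

Lemma qpi_repr x : qpi (repr x) = x. Proof. exact: reprK. Qed.

Lemma repr_qpi v : repr (qpi v) - v \in W.
Proof. by apply/qpi_eq; rewrite qpi_repr. Qed.

Lemma qpi_is_zmod_morphism : zmod_morphism qpi.
Proof. by move=> u v; rewrite /qpi raddfB. Qed.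

HB.instance Definition _ :=
  GRing.isZmodMorphism.Build V quotmod qpi qpi_is_zmod_morphism.

Lemma qscaleE a v : qscale a (qpi v) = qpi (a *: v).
Proof. by apply/qpi_eq; rewrite -scalerBr; apply/rpredZ/repr_qpi. Qed.

Lemma qscaleA a b x : qscale a (qscale b x) = qscale (a * b) x.
Proof. by rewrite -[x]qpi_repr !qscaleE scalerA. Qed.

Lemma qscale1 : left_id 1 qscale.
Proof. by move=> x; rewrite -[x]qpi_repr !qscaleE scale1r. Qed.

Lemma qscaleDr : right_distributive qscale +%R.
Proof.
move=> a x y; rewrite -[x]qpi_repr -[y]qpi_repr -raddfD !qscaleE.
by rewrite scalerDr raddfD.
Qed.

Lemma qscaleDl x : {morph qscale^~ x : a b / a + b}.
Proof. by move=> a b; rewrite -[x]qpi_repr !qscaleE scalerDl raddfD. Qed.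

HB.instance Definition _ := GRing.Zmodule_isLmodule.Build k quotmod
  qscaleA qscale1 qscaleDr qscaleDl.

Lemma qpi_is_scalable : scalable qpi.
Proof. by move=> a v; rewrite -qscaleE. Qed.

HB.instance Definition _ :=
  GRing.isScalable.Build k V quotmod *:%R qpi qpi_is_scalable.

Lemma qpi_eq0 v : qpi v = 0 <-> v \in W.
Proof. by rewrite -(raddf0 qpi) qpi_eq subr0. Qed.

Section Lift.
Context (U : lmodType k) (f : {linear V -> U}).
Hypothesis f0 : forall v, v \in W -> f v = 0.

Definition qlift of (forall v, v \in W -> f v = 0) :=
  fun x : quotmod => f (repr x).

Lemma qliftE v : qlift f0 (qpi v) = f v.
Proof.
by apply/eqP; rewrite -subr_eq0 -linearB; apply/eqP/f0/repr_qpi.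
Qed.

Lemma qlift_is_linear : linear (qlift f0).
Proof.
move=> a x y; rewrite -[x]qpi_repr -[y]qpi_repr -linearP !qliftE.
exact: linearP.
Qed.

HB.instance Definition _ :=
  GRing.isLinear.Build k quotmod U *:%R (qlift f0) qlift_is_linear.

End Lift.
End QuotientModule.

Lemma fglift_is_linear (k : fieldType) (T : choiceType) (M : lmodType k)
  (f : T -> M) : linear (fglift f : {freeg T / k} -> M).
Proof.
pose g : {freeg T / k} -> M := fglift f.
have gB : zmod_morphism g by exact: lift_is_additive.
pose G := GRing.isZmodMorphism.Build _ _ g gB.
pose h : {additive {freeg T / k} -> M} := HB.pack g G.
have gZ a D : h (a *: D) = a *: h D.
  rewrite -[in RHS](freeg_sumE D) -[a *: D]/(fgscale a D) /fgscale.
  rewrite !(raddf_sum h) scaler_sumr; apply: eq_bigr => x _.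
  by rewrite -![h _]/(fglift f _) !liftU scalerA.
by move=> a D E; rewrite -[LHS]/(h _) raddfD gZ.
Qed.

HB.instance Definition _ (k : fieldType) (T : choiceType) (M : lmodType k)
    (f : T -> M) :=
  GRing.isLinear.Build k {freeg T / k} M *:%R (fglift f) (fglift_is_linear f).

Record simplicial_complex (X : choiceType) := SimplicialComplex {
  simplex : set {fset X};
  simplex_neq0 : forall s, simplex s -> s != fset0;
  simplex_face : forall s t, simplex s -> (t `<=` s)%fset -> t != fset0 ->
    simplex t }.

Definition subcomplex (X : choiceType) (K L : simplicial_complex X) :=
  simplex K `<=` simplex L.

Section OrientedChains.
Context (k : fieldType) (X : choiceType).

Let free := {freeg (seq X) / k}.
Let gen (s : seq X) : free := << (1 : k) *g s >>.

Definition orientation_relations : set free :=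
  [set c | (exists2 s, ~~ uniq s & c = gen s) \/
           exists s x y t, c = gen (s ++ x :: y :: t) + gen (s ++ y :: x :: t)].

(* The p-chains of the full simplex on X, for all p at once; the class of
   x_0, ..., x_p is the oriented simplex [x_0, ..., x_p].  Exchanging two
   neighbours changes the sign, so a permutation of the vertices acts by its
   signature, and [x_0, ..., x_p] is 0 if a vertex is repeated.  Oriented
   simplices are otherwise independent, so that the chains of a complex K embed
   as the span of its oriented simplices; the empty sequence spans no simplex
   of K and does not contribute. *)
Definition ochain : Type := quotmod (lspan orientation_relations).
HB.instance Definition _ := GRing.Lmodule.on ochain.

Definition osimplex (s : seq X) : ochain :=
  qpi (lspan orientation_relations) (gen s).

Definition face (i : nat) (s : seq X) := take i s ++ drop i.+1 s.

(* Homology is not reduced: the boundary of a vertex is 0. *)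
Definition bd_osimplex (s : seq X) : ochain :=
  if (size s <= 1)%N then 0
  else \sum_(i < size s) (-1) ^+ i *: osimplex (face i s).

Lemma osimplex_nuniq s : ~~ uniq s -> osimplex s = 0.
Proof. by move=> us; apply/qpi_eq0/mem_lspan; left; exists s. Qed.

Lemma osimplex_swap s x y t :
  osimplex (s ++ x :: y :: t) = - osimplex (s ++ y :: x :: t).
Proof.
apply/eqP; rewrite -addr_eq0 -raddfD; apply/eqP/qpi_eq0/mem_lspan.
by right; exists s, x, y, t.
Qed.

Let dd (s : seq X) : ochain :=
  \sum_(i < size s) (-1) ^+ i *: osimplex (face i s).

Let ddE s : (1 < size s)%N -> bd_osimplex s = dd s.
Proof. by move=> s_gt1; rewrite /bd_osimplex leqNgt s_gt1. Qed.

Let dd_cat s t : dd (s ++ t) =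
  \sum_(i < size s) (-1) ^+ i *: osimplex (face i s ++ t) +
  (-1) ^+ size s *: \sum_(i < size t) (-1) ^+ i *: osimplex (s ++ face i t).
Proof.
rewrite /dd size_cat big_split_ord /=; congr (_ + _).
  apply: eq_bigr => i _; congr (_ *: osimplex _).
  rewrite /face take_cat drop_cat ltn_ord.
  have [lt|] := ltnP i.+1 (size s); first by rewrite catA.
  move=> le; have e : i.+1 = size s by apply/eqP; rewrite eqn_leq le ltn_ord.
  by rewrite e subnn drop0 drop_size cats0.
rewrite scaler_sumr; apply: eq_bigr => i _.
rewrite scalerA -exprD; congr (_ *: osimplex _).
rewrite /face take_cat drop_cat ltnNge leq_addr /= ltnNge.
by rewrite -addnS leq_addr /= !addKn catA.
Qed.

Let dd_swap s x y t : dd (s ++ x :: y :: t) = - dd (s ++ y :: x :: t).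
Proof.
rewrite !dd_cat /= opprD; congr (_ + _).
  rewrite -sumrN; apply: eq_bigr => i _.
  by rewrite osimplex_swap scalerN.
rewrite -scalerN; congr (_ *: _).
rewrite !big_ord_recl /= /face /= /bump /= !drop0 expr0 expr1 !scaleN1r !scale1r.
rewrite !opprD opprK -sumrN addrCA; congr (_ + (_ + _)).
by apply: eq_bigr => i _; rewrite osimplex_swap scalerN.
Qed.

Let dd_nuniq s : ~~ uniq s -> dd s = 0.
Proof.
have main p1 p2 p3 x : dd (p1 ++ x :: p2 ++ x :: p3) = 0.
  elim: p2 p1 => [|y p2 IH] p1 /=; last first.
    by rewrite dd_swap -cat_rcons IH oppr0.
  have nu p q : ~~ uniq (p ++ x :: x :: q).
    by rewrite cat_uniq /= inE eqxx /= !andbF.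
  rewrite dd_cat big1 ?add0r => [|i _]; last by rewrite osimplex_nuniq ?scaler0.
  rewrite /= !big_ord_recl /= /face /= /bump /= !drop0.
  rewrite expr0 expr1 scaleN1r scale1r addrA subrr add0r big1 ?scaler0 // => i _.
  by rewrite osimplex_nuniq ?scaler0.
elim: s {-2}s (erefl s) => [|x s IH] s0 ->//=.
suff: forall p t, ~~ uniq t -> dd (p ++ t) = 0 by move=> /(_ [::] (x :: s)).
move=> p t; elim: t p => [//|y t IHt] p /=.
rewrite negb_and negbK => /orP[yt|nt].
  by case/splitPr: yt => p2 p3; exact: main.
by rewrite -cat_rcons IHt.
Qed.

Lemma bd_relations (c : free) :
  c \in lspan orientation_relations -> fglift bd_osimplex c = 0.
Proof.
apply: lspan_ind_eq0 => _ [[s us ->]|[s [x [y [t ->]]]]] /=.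
  rewrite liftU scale1r /bd_osimplex; case: ifP => // _; exact: dd_nuniq.
rewrite linearD /= !liftU !scale1r !ddE ?size_cat /= ?addnS//.
by rewrite dd_swap addNr.
Qed.

Definition bd : ochain -> ochain := qlift bd_relations.
HB.instance Definition _ := GRing.Linear.on bd.

Lemma bdE s : bd (osimplex s) = bd_osimplex s.
Proof. by rewrite /bd /osimplex qliftE /= liftU scale1r. Qed.

Section Homology.
Context (K : simplicial_complex X).

Definition chains : {pred ochain} :=
  lspan [set c | exists2 s, simplex K [fset x in s]%fset & c = osimplex s].

HB.instance Definition _ := GRing.SubmodClosed.on chains.

Definition cycles : {pred ochain} := fun c => (c \in chains) && (bd c == 0).

Lemma cycles_submod_closed : subsemimod_closed cycles.
Proof.
split; first split.
- by rewrite unfold_in rpred0 linear0 eqxx.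
- move=> c d /andP[cK /eqP c0] /andP[dK /eqP d0].
  by rewrite unfold_in rpredD//= linearD /= c0 d0 addr0.
- move=> a c /andP[cK /eqP c0].
  by rewrite unfold_in rpredZ//= linearZ /= c0 scaler0.
Qed.

HB.instance Definition _ :=
  GRing.isSubmodClosed.Build k ochain cycles cycles_submod_closed.

Definition boundaries : {pred submodule cycles} :=
  fun z => `[< exists2 c, c \in chains & val z = bd c >].

Lemma boundaries_submod_closed : subsemimod_closed boundaries.
Proof.
split; first split.
- apply/asboolP; exists 0; first exact: rpred0.
  by rewrite [RHS]linear0 [LHS]linear0.
- move=> z w /asboolP[c cK zc] /asboolP[d dK wd]; apply/asboolP.
  by exists (c + d); rewrite ?rpredD// linearD /= zc wd linearD.
- move=> a z /asboolP[c cK zc]; apply/asboolP.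
  by exists (a *: c); rewrite ?rpredZ// linearZ /= zc linearZ.
Qed.

HB.instance Definition _ := GRing.isSubmodClosed.Build k (submodule cycles)
  boundaries boundaries_submod_closed.

(* Total homology: [bd] is homogeneous of degree -1, so this quotient is the
   direct sum over p of the degree p homology groups. *)
Definition homology : lmodType k := quotmod boundaries.

End Homology.

Arguments boundaries : clear implicits.

Section Inclusion.
Context (K L : simplicial_complex X) (KL : subcomplex K L).

Lemma chains_subcomplex c : c \in chains K -> c \in chains L.
Proof.
move=> /asboolP[s [sK ->]]; apply/asboolP; exists s; split=> // p /sK[t tK ->].
by exists t => //; exact: KL.
Qed.

Lemma cycles_subcomplex c : c \in cycles K -> c \in cycles L.
Proof. by move=> /andP[/chains_subcomplex cL c0]; apply/andP. Qed.

Definition cycle_incl (z : submodule (cycles K)) : submodule (cycles L) :=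
  exist _ (val z) (cycles_subcomplex (valP z)).

Lemma cycle_incl_is_linear : linear cycle_incl.
Proof.
move=> a z w; apply: val_inj; rewrite -[LHS]/(val (a *: z + w)).
by rewrite [LHS]linearP [RHS]linearP.
Qed.

HB.instance Definition _ := GRing.isLinear.Build k
  (submodule (cycles K)) (submodule (cycles L)) *:%R
  cycle_incl cycle_incl_is_linear.

Lemma boundary_incl z :
  z \in boundaries K -> (qpi (boundaries L) \o cycle_incl) z = 0.
Proof.
move=> /asboolP[c cK zc]; apply/qpi_eq0/asboolP.
by exists c => //; exact: chains_subcomplex.
Qed.

Definition homology_incl : {linear homology K -> homology L} :=
  qlift boundary_incl.

Lemma homology_inclE z :
  homology_incl (qpi (boundaries K) z) = qpi (boundaries L) (cycle_incl z).
Proof. exact: (qliftE boundary_incl). Qed.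

End Inclusion.
End OrientedChains.

Record persistence_module (R : realType) (k : fieldType) := PersistenceModule {
  pm_space :> R -> lmodType k;
  pm_map : forall a b, a <= b -> {linear pm_space a -> pm_space b};
  pm_map_id : forall a (aa : a <= a) x, pm_map aa x = x;
  pm_map_comp : forall a b c (ab : a <= b) (bc : b <= c) (ac : a <= c) x,
    pm_map bc (pm_map ab x) = pm_map ac x }.

Section Interleaving.
Context (R : realType) (k : fieldType).

Record pm_hom (eps : R) (U V : persistence_module R k) := PMHom {
  pm_hom_fun :> forall a, {linear U a -> V (a + eps)};
  pm_homP : forall a b (ab : a <= b) (ab' : a + eps <= b + eps) x,
    pm_map V ab' (pm_hom_fun a x) = pm_hom_fun b (pm_map U ab x) }.

Lemma ler_shift2 (eps : R) : 0 <= eps -> forall a, a <= a + eps + eps.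
Proof. by move=> e0 a; rewrite -addrA lerDl addr_ge0. Qed.

(* The structure map from a to a + 2 eps only makes sense for eps >= 0. *)
Definition interleaved (eps : R) (U V : persistence_module R k) : Prop :=
  exists e0 : 0 <= eps,
  exists (Phi : pm_hom eps U V) (Psi : pm_hom eps V U),
    (forall a x, Psi (a + eps) (Phi a x) = pm_map U (ler_shift2 e0 a) x) /\
    (forall a y, Phi (a + eps) (Psi a y) = pm_map V (ler_shift2 e0 a) y).

End Interleaving.

Record filtered_complex (R : realType) (X : choiceType) := FilteredComplex {
  filtration :> R -> simplicial_complex X;
  filtration_sub : forall a b, a <= b ->
    subcomplex (filtration a) (filtration b) }.

Arguments filtration_sub {R X} f [a b].

Section PersistentHomology.
Context (R : realType) (k : fieldType) (X : choiceType).
Context (F : filtered_complex R X).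

Let ph_map a b (ab : a <= b) : {linear homology k (F a) -> homology k (F b)} :=
  homology_incl k (filtration_sub F ab).

Lemma ph_map_id a (aa : a <= a) x : ph_map aa x = x.
Proof.
rewrite -[x]qpi_repr [LHS]homology_inclE.
by congr (qpi _ _); exact: val_inj.
Qed.

Lemma ph_map_comp a b c (ab : a <= b) (bc : b <= c) (ac : a <= c) x :
  ph_map bc (ph_map ab x) = ph_map ac x.
Proof.
rewrite -[x]qpi_repr /ph_map [in LHS]homology_inclE.
by rewrite !homology_inclE; congr (qpi _ _); exact: val_inj.
Qed.

Definition persistent_homology : persistence_module R k :=
  PersistenceModule ph_map_id ph_map_comp.

End PersistentHomology.

Section GromovHausdorff.
Context (R : realType) (X Y : metricType R).

Definition correspondence (C : set (X * Y)) : Prop :=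
  fst @` C = [set: X] /\ snd @` C = [set: Y].

(* The supremum is taken in [0, +oo], so it is 0 on the empty correspondence. *)
Definition distortion (C : set (X * Y)) : \bar R :=
  maxe 0%:E (ereal_sup
    [set (`|mdist p.1 q.1 - mdist p.2 q.2|)%:E | p in C & q in C]).

Definition gromov_hausdorff : \bar R :=
  ((2^-1)%:E * ereal_inf [set distortion C | C in correspondence])%E.

End GromovHausdorff.

Section Cech.
Context (R : realType) (X : metricType R).

(* library balls are open, and [closed_ball] is the closure of the open ball *)
Definition cball (x : X) (a : R) : set X := [set y | mdist x y <= a].

Definition cech_simplex (a : R) (s : {fset X}) : Prop :=
  s != fset0 /\ \bigcap_(x in [set` s]) cball x a !=set0.

Lemma cech_simplex_face a s t : cech_simplex a s -> (t `<=` s)%fset ->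
  t != fset0 -> cech_simplex a t.
Proof.
move=> [_ [z sz]] /fsubsetP ts t0; split=> //.
by exists z => x /ts; exact: sz.
Qed.

Definition cech (a : R) : simplicial_complex X :=
  SimplicialComplex (fun s => @proj1 (s != fset0) _) (@cech_simplex_face a).

Lemma cech_sub a b : a <= b -> subcomplex (cech a) (cech b).
Proof.
move=> ab s [s0 [z sz]]; split=> //; exists z => x /sz.
by move=> /le_trans; apply.
Qed.

Definition cech_filtration : filtered_complex R X := FilteredComplex cech_sub.

End Cech.

Arguments cech_filtration {R} X.
Arguments persistent_homology {R} k {X} F.

(* Main.v *)
From HB Require Import structures.
Require Import Defs.
From mathcomp Require Import all_boot all_order all_algebra finmap.
From mathcomp Require Import all_classical all_reals ereal topology.
From mathcomp Require Import freeg.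

(** Since the Gromov-Hausdorff distance is half an infimum of distortions, some
correspondence [C] has distortion less than [eps].  Selecting partners in [C]
gives maps [f : X -> Y] and [g : Y -> X] that lengthen distances by at most
[eps].  If the points of a simplex of the Cech complex of [X] at scale [a] are
within [a] of a common centre [z], their images are within [a + eps] of [f z];
so [f] is simplicial from scale [a] to scale [a + eps], and so is [g].  Going
back and forth is harmless in homology: for [x] within [a] of [z], the point
[g (f x)] is related to [f x] and [z] to [f z], hence [g (f x)] is within
[a + 2 eps] of the same [z].  So a simplex and its image under [g \o f] span a
common simplex at scale [a + 2 eps]: the map [g \o f] is contiguous to the
inclusion ([cech_contiguous]), and contiguous maps agree in homology
([contiguous_homologous]).

The last fact is where the work lies.  The usual prism operator depends on an
ordering of the vertices of a simplex, so it does not descend to oriented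
chains, in which a permutation of vertices acts by its sign.  It does descend
when the two maps differ at a single vertex [v], because then only the term
that doubles [v] survives; this is [prism], and [prism_homotopy] is the
homotopy identity.  A cycle involves finitely many vertices
([chains_support]), so one contiguous map is turned into the other by changing
the image of one vertex after another, each change moving the cycle by a
boundary. *)

Set Implicit Arguments.
Unset Strict Implicit.
Unset Printing Implicit Defensive.

Import Order.TTheory GRing.Theory Num.Theory.

Local Open Scope classical_set_scope.
Local Open Scope ring_scope.

(** * Linear maps out of oriented chains *)

Section OrientedChainMaps.
Context (k : fieldType) (X : choiceType) (M : lmodType k).

Lemma ochain_ext (f g : {linear ochain k X -> M}) :
  (forall s, f (osimplex k s) = g (osimplex k s)) -> f =1 g.
Proof.
move=> fg c; rewrite -[c]qpi_repr -(freeg_sumE (repr c)).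
rewrite (raddf_sum (@qpi k _ (lspan _))) !linear_sum.
apply: eq_bigr => s _.
have -> : << coeff s (repr c) *g s >> =
    coeff s (repr c) *: (<< (1 : k) *g s >> : {freeg (seq X) / k}).
  by apply/eqP/freeg_eqP => t; rewrite coeffZ !coeffU mul1r.
rewrite /=; have -> : qpi (lspan _) (coeff s (repr c) *: << (1 : k) *g s >>) =
    coeff s (repr c) *: osimplex k s by rewrite linearZ.
by rewrite !linearZ fg.
Qed.

Variable F : seq X -> M.
Hypothesis F_nuniq : forall s, ~~ uniq s -> F s = 0.
Hypothesis F_swap : forall s x y t,
  F (s ++ x :: y :: t) = - F (s ++ y :: x :: t).

Lemma fglift_relations c :
  c \in lspan (@orientation_relations k X) -> fglift F c = 0.
Proof.
apply: lspan_ind_eq0 => _ [[s us ->]|[s [x [y [t ->]]]]] /=.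
  by rewrite liftU scale1r F_nuniq.
by rewrite linearD /= !liftU !scale1r F_swap addNr.
Qed.

(** The universal property of oriented chains: alternating functions of
vertex sequences extend linearly.  The extension is kept behind an opaque
existence proof, so that simplification never unfolds it to representatives of
classes and [oliftE] is its only computation rule. *)
Fact olift_subproof :
  {f : {linear ochain k X -> M} | forall s, f (osimplex k s) = F s}.
Proof.
exists (qlift fglift_relations) => s.
by rewrite [LHS](qliftE fglift_relations) /= liftU scale1r.
Qed.

Definition olift := sval olift_subproof.

Lemma oliftE s : olift (osimplex k s) = F s.
Proof. exact: (svalP olift_subproof). Qed.

End OrientedChainMaps.

Lemma notin_pivot (T : eqType) (s t : seq T) x :
  uniq (s ++ x :: t) -> (x \notin s) && (x \notin t).
Proof.
by rewrite uniq_catC /= mem_cat negb_or andbC => /andP[_]; rewrite andbC.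
Qed.

Section Pivot.
Context (k : fieldType) (X : choiceType).

Lemma osimplex_pivot (s : seq X) x t :
  osimplex k (s ++ x :: t) = (-1) ^+ size s *: osimplex k (x :: s ++ t).
Proof.
elim/last_ind: s t => [t|s y IH t] /=; first by rewrite scale1r.
rewrite !cat_rcons osimplex_swap IH size_rcons exprS mulN1r scaleNr.
by rewrite -cat_rcons.
Qed.

(** Up to sign, a simplex that contains [v] has [v] as its first vertex.
Checking an identity on such simplices leaves no position to keep track of. *)
Lemma ochain_ext_pivot (M : lmodType k) (v : X)
    (f g : {linear ochain k X -> M}) :
  (forall s, v \notin s -> f (osimplex k s) = g (osimplex k s)) ->
  (forall s, v \notin s -> f (osimplex k (v :: s)) = g (osimplex k (v :: s))) ->
  f =1 g.
Proof.
move=> fg fgv; apply: ochain_ext => s.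
have [us|/osimplex_nuniq-> //] := boolP (uniq s); last by rewrite !linear0.
have [vs|] := boolP (v \in s); last exact: fg.
case/splitPr: vs us => s1 s2; rewrite osimplex_pivot !linearZ /= => us.
by rewrite fgv // mem_cat negb_or; exact: notin_pivot.
Qed.

Lemma face_map (Y : choiceType) (f : X -> Y) i s :
  face i (map f s) = map f (face i s).
Proof. by rewrite /face map_cat map_take map_drop. Qed.

Lemma face0 x (s : seq X) : face 0 (x :: s) = s.
Proof. by rewrite /face /= drop0. Qed.

Lemma faceS i x (s : seq X) : face i.+1 (x :: s) = x :: face i s.
Proof. by []. Qed.

Lemma mem_face i (s : seq X) : {subset face i s <= s}.
Proof. by move=> x; rewrite mem_cat => /orP[/mem_take|/mem_drop]. Qed.

End Pivot.

(** * Chain maps and the prism at a vertex *)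

Section Pushforward.
Context (k : fieldType) (X Y : choiceType) (h : X -> Y).

Let push_nuniq s : ~~ uniq s -> osimplex k (map h s) = 0.
Proof. by move=> us; apply/osimplex_nuniq/(contra _ us); exact: map_uniq. Qed.

Let push_swap s x y t : osimplex k (map h (s ++ x :: y :: t)) =
  - osimplex k (map h (s ++ y :: x :: t)).
Proof. by rewrite !map_cat /= osimplex_swap. Qed.

Definition push : {linear ochain k X -> ochain k Y} :=
  olift push_nuniq push_swap.

Lemma pushE s : push (osimplex k s) = osimplex k (map h s).
Proof. exact: oliftE. Qed.

Lemma push_bd c : push (bd c) = bd (push c).
Proof.
pose f : {linear ochain k X -> ochain k Y} := push \o @bd k X.
pose g : {linear ochain k X -> ochain k Y} := @bd k Y \o push.
apply: (@ochain_ext _ _ _ f g) => s.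
rewrite /f /g /= pushE !bdE /bd_osimplex size_map.
case: ifP => _; first by rewrite linear0.
rewrite linear_sum; apply: eq_bigr => i _.
by rewrite linearZ /= pushE face_map.
Qed.

End Pushforward.

Section Prism.
Context (k : fieldType) (X Y : choiceType) (v : X) (h h' : X -> Y).

(** For a sequence with [v] in position [i], this is the term
[(-1)^i [h x_0, ..., h v, h' v, ..., h' x_p]] of the classical prism operator
when [h'] agrees with [h] away from [v], rewritten with the doubled vertex in
front: moving a pair of vertices costs no sign.  In that case the other terms
of the prism operator repeat a vertex and vanish. *)
Let prism_gen (s : seq X) : ochain k Y :=
  if v \in s then
    (-1) ^+ index v s *: osimplex k (h v :: h' v :: map h (rem v s))
  else 0.

Let prism_pivot s t : v \notin s -> prism_gen (s ++ v :: t) =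
  (-1) ^+ size s *: osimplex k (h v :: h' v :: map h (s ++ t)).
Proof.
move=> vs; rewrite /prism_gen mem_cat mem_head orbT remE /=.
rewrite take_pivot // index_pivot // -cat_rcons drop_cat size_rcons ltnn.
by rewrite subnn drop0.
Qed.

Let prism_nuniq s : ~~ uniq s -> prism_gen s = 0.
Proof.
move=> us; rewrite /prism_gen; case: ifP => // vs.
rewrite osimplex_nuniq ?scaler0 //; apply: contra us => us.
rewrite (perm_uniq (perm_to_rem vs)); apply: (@map_uniq _ _ h).
by move: us; rewrite /= inE negb_or -andbA => /and4P[_ -> _ ->].
Qed.

(** A transposition away from [v] acts on the vertices that follow the doubled
one; a transposition that involves [v] shifts its index by one. *)
Let prism_swap s x y t :
  prism_gen (s ++ x :: y :: t) = - prism_gen (s ++ y :: x :: t).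
Proof.
have [us|nus] := boolP (uniq (s ++ x :: y :: t)); last first.
  rewrite !prism_nuniq ?oppr0 //; apply: contra nus => us.
  rewrite (perm_uniq (s2 := s ++ y :: x :: t)) //.
  by rewrite perm_cat2l (perm_catCA [:: x] [:: y]).
have hswap p q : osimplex k (h v :: h' v :: map h (p ++ x :: y :: q)) =
    - osimplex k (h v :: h' v :: map h (p ++ y :: x :: q)).
  by rewrite !map_cat; exact: (osimplex_swap k (h v :: h' v :: map h p)).
have adj z r : v \notin s -> v != z -> prism_gen (s ++ v :: z :: r) =
    - prism_gen (s ++ z :: v :: r).
  move=> vs vz; rewrite -(cat_rcons z s (v :: r)) !prism_pivot //; last first.
    by rewrite mem_rcons inE negb_or vz.
  by rewrite cat_rcons size_rcons exprS mulN1r scaleNr opprK.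
have [vs|vs] := boolP (v \in s).
  case/splitPr: vs us => p q; rewrite -!catA !cat_cons => us.
  have /andP[vp _] := notin_pivot us.
  by rewrite !prism_pivot // !catA hswap scalerN.
have xy : x != y.
  move: us; rewrite -cat_rcons => /notin_pivot.
  by rewrite mem_rcons inE negb_or eq_sym => /andP[/andP[]].
have [vx|vx] := eqVneq v x; first by rewrite -vx in xy *; exact: adj.
have [vy|vy] := eqVneq v y.
  by rewrite -vy in xy *; rewrite adj ?opprK // eq_sym.
have [vt|vt] := boolP (v \in t); last first.
  rewrite /prism_gen !mem_cat !inE.
  by rewrite (negPf vs) (negPf vx) (negPf vy) (negPf vt) oppr0.
case/splitPr: vt us => p q us.
have vp : v \notin p.
  move: us; rewrite -!cat_cons catA => /notin_pivot/andP[+ _].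
  by rewrite mem_cat !inE !negb_or => /and4P[].
rewrite -(cat_cons y p) -(cat_cons x (y :: p)).
rewrite -(cat_cons x p) -(cat_cons y (x :: p)).
rewrite !(catA s) !prism_pivot.
- by rewrite -!(catA s) !cat_cons hswap scalerN !size_cat.
- by rewrite mem_cat !inE !negb_or vs vx vy.
- by rewrite mem_cat !inE !negb_or vs vx vy.
Qed.

Definition prism : {linear ochain k X -> ochain k Y} :=
  olift prism_nuniq prism_swap.

Lemma prism_notin s : v \notin s -> prism (osimplex k s) = 0.
Proof. by move=> vs; rewrite /prism oliftE /prism_gen (negPf vs). Qed.

Lemma prism_cons t :
  prism (osimplex k (v :: t)) = osimplex k (h v :: h' v :: map h t).
Proof.
by rewrite /prism oliftE /prism_gen mem_head /= eqxx scale1r.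
Qed.

Hypothesis hh' : forall x, x != v -> h' x = h x.

(** On a simplex [[v, t]] the two faces of [[h v, h' v, h t]] that omit [h v]
or [h' v] are the two push-forwards, and its other faces cancel against the
prism of the faces of [[v, t]] that contain [v].  Simplices without [v] have
the same push-forwards and no prism. *)
Lemma prism_homotopy c :
  bd (prism c) + prism (bd c) = push k h' c - push k h c.
Proof.
pose f : {linear ochain k X -> ochain k Y} :=
  (@bd k Y \o prism) \+ (prism \o @bd k X).
pose g : {linear ochain k X -> ochain k Y} := push k h' \- push k h.
have maph s : v \notin s -> map h' s = map h s.
  move=> vs; apply/eq_in_map => x xs.
  by rewrite hh' //; apply: contraNneq vs => <-.
have prism_face s i : v \notin s -> prism (osimplex k (face i s)) = 0.
  by move=> vs; rewrite prism_notin //; apply: contra vs => /mem_face.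
apply: (@ochain_ext_pivot _ _ _ v f g) => s vs; rewrite /f /g /= !pushE bdE.
  rewrite maph // subrr prism_notin // linear0 add0r /bd_osimplex.
  case: ifP => _; first by rewrite linear0.
  rewrite linear_sum big1 // => i _.
  by rewrite linearZ /= prism_face // scaler0.
rewrite prism_cons !bdE /bd_osimplex /= size_map maph //.
rewrite 2!big_ord_recl /= /bump /= faceS !face0 expr0 expr1 scale1r scaleN1r.
rewrite addrA -[RHS]addr0 -[LHS]addrA; congr (_ + _).
(* The boundary of the vertex [v] is 0 and not the empty simplex, but the
   prism of the empty simplex is 0 as well. *)
case: (posnP (size s)) => [->|s0].
  by rewrite /= linear0 big_ord0 addr0.
rewrite leqNgt ltnS s0 /= big_ord_recl /= face0 linearD linearZ /=.
rewrite prism_notin // scaler0 add0r linear_sum -big_split big1 // => i _.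
rewrite /= /bump /= !add1n !faceS linearZ /= prism_cons face_map.
by rewrite -scalerDl !exprS !mulN1r opprK subrr scale0r.
Qed.

End Prism.

(** * Contiguous maps are homologous *)

Section Chains.
Context (k : fieldType) (X : choiceType) (K : simplicial_complex X).

Lemma chains_ind (V : lmodType k) (W : submodClosed V)
    (f : {linear ochain k X -> V}) :
  (forall s, simplex K [fset x in s]%fset -> f (osimplex k s) \in W) ->
  forall c, c \in chains K -> f c \in W.
Proof.
move=> fW c /asboolP[s [sK ->]]; rewrite linear_sum big_seq.
by apply: rpred_sum => p /sK[t tK pt]; rewrite linearZ /= pt; apply/rpredZ/fW.
Qed.

Lemma osimplex_chains s :
  simplex K [fset x in s]%fset -> osimplex k s \in chains K.
Proof. by move=> sK; apply: mem_lspan; exists s. Qed.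

Lemma chains_support c : c \in chains K -> exists e : seq X,
  forall (Y : choiceType) (f g : X -> Y), {in e, f =1 g} ->
    push k f c = push k g c.
Proof.
move=> /asboolP[r [rK ->]]; elim: r rK => [|p r IH] rK.
  by exists [::] => Y f g _; rewrite big_nil !linear0.
have [|e eP] := IH; first by move=> q qr; apply: rK; rewrite inE qr orbT.
have [s sK ps] := rK p (mem_head _ _); exists (s ++ e) => Y f g fg.
rewrite big_cons !linearD !linearZ /= ps !pushE.
rewrite (eP Y f g) => [|x xe]; last by apply: fg; rewrite mem_cat xe orbT.
congr (_ *: osimplex k _ + _); apply/eq_in_map => x xs.
by apply: fg; rewrite mem_cat xs.
Qed.

End Chains.

Section Contiguity.
Context (k : fieldType) (X Y : choiceType).
Context (K : simplicial_complex X) (L : simplicial_complex Y).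
Implicit Types f g h : X -> Y.

Definition simplicial f :=
  forall s, simplex K s -> simplex L (f @` s)%fset.

Definition contiguous f g :=
  forall s, simplex K s -> simplex L (f @` s `|` g @` s)%fset.

Lemma push_chains f c :
  simplicial f -> c \in chains K -> push k f c \in chains L.
Proof.
move=> fKL; apply: chains_ind => s sK; rewrite pushE; apply: osimplex_chains.
rewrite (_ : [fset y in _]%fset = f @` [fset x in s])%fset; first exact: fKL.
by apply/fsetP => y; rewrite !inE; apply/mapP/imfsetP => -[x xs ->]; exists x;
  rewrite ?inE // in xs *.
Qed.

Lemma prism_chains (v : X) h h' c :
  contiguous h h' -> c \in chains K -> prism k v h h' c \in chains L.
Proof.
move=> hh'; apply: chains_ind => s.
have [us sK|/osimplex_nuniq->] := boolP (uniq s); last first.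
  by rewrite linear0 rpred0.
have [vs|vs] := boolP (v \in s); last by rewrite prism_notin // rpred0.
have vh' : h' v \in (h' @` [fset x in s])%fset by rewrite in_imfset //= inE.
have sh x : x \in s -> h x \in (h @` [fset x in s])%fset.
  by move=> xs; rewrite in_imfset //= inE.
have := hh' _ sK; case/splitPr: vs us sh vh' {sK} => s1 s2 us sh vh' sL.
rewrite osimplex_pivot linearZ /= prism_cons; apply/rpredZ/osimplex_chains.
apply: simplex_face sL _ _; last first.
  by apply/fset0Pn; exists (h v); rewrite !inE eqxx.
apply/fsubsetP => y; rewrite !inE => /or3P[/eqP->|/eqP->|/mapP[x xs ->]].
- by rewrite sh // mem_cat mem_head orbT.
- by rewrite vh' orbT.
- by rewrite sh //; move: xs; rewrite !mem_cat inE => /orP[->|->]; rewrite ?orbT.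
Qed.

(** The maps [mix e] interpolate between [f] (for empty [e]) and a map that
agrees with [g] on the vertices of [z].  All of them are contiguous to each
other, since they send a simplex into the union of its images under [f] and
[g]; consecutive ones differ at one vertex. *)
Lemma contiguous_homologous f g z : contiguous f g -> z \in cycles K ->
  exists2 c, c \in chains L & push k g z - push k f z = bd c.
Proof.
move=> fg /andP[zK /eqP z0].
pose mix (e : seq X) x := if x \in e then g x else f x.
have mixE e s y : y \in (mix e @` s)%fset -> y \in (f @` s `|` g @` s)%fset.
  move=> /imfsetP[x /= xs ->]; rewrite inE /mix.
  by case: ifP => _; rewrite !in_imfset //= orbT.
have mix_contiguous e e' : contiguous (mix e) (mix e').
  move=> s sK; apply: simplex_face (fg s sK) _ _.
    by apply/fsubsetP => y; rewrite in_fsetU => /orP[] /mixE.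
  have /fset0Pn[x xs] := simplex_neq0 sK.
  by apply/fset0Pn; exists (mix e x); rewrite inE in_imfset.
have mix_homologous e : exists2 c, c \in chains L &
    push k (mix e) z - push k f z = bd c.
  elim: e => [|v e [c cL cE]].
    exists 0; first exact: rpred0.
    by rewrite linear0 (_ : mix [::] = f) ?subrr.
  exists (prism k v (mix e) (mix (v :: e)) z + c).
    by rewrite rpredD // prism_chains.
  have := @prism_homotopy k X Y v (mix e) (mix (v :: e)) _ z.
  rewrite z0 linear0 addr0 linearD /= -cE => -> => [|x xv].
    by rewrite addrA subrK.
  by rewrite /mix inE (negPf xv).
have [e eP] := chains_support zK.
have [c cL cE] := mix_homologous e; exists c => //; rewrite -cE; congr (_ - _).
by apply: eP => x xe; rewrite /mix xe.
Qed.

End Contiguity.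

(** * Simplicial maps in homology *)

Section HomologyMap.
Context (k : fieldType) (X Y : choiceType).
Context (K : simplicial_complex X) (L : simplicial_complex Y).
Context (f : X -> Y) (fKL : simplicial K L f).

Lemma push_cycles c : c \in cycles (k := k) K -> push k f c \in cycles L.
Proof.
move=> /andP[cK /eqP c0]; apply/andP; split; first exact: push_chains cK.
by rewrite -push_bd c0 linear0.
Qed.

Definition cycle_push (z : submodule (cycles (k := k) K)) :
    submodule (cycles (k := k) L) :=
  exist _ (push k f (val z)) (push_cycles (valP z)).

Lemma cycle_push_is_linear : linear cycle_push.
Proof. by move=> a z w; apply: val_inj; rewrite [RHS]linearP /= !linearP. Qed.

HB.instance Definition _ := GRing.isLinear.Build k
  (submodule (cycles K)) (submodule (cycles L)) *:%R
  cycle_push cycle_push_is_linear.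

Lemma boundary_push z :
  z \in @boundaries k _ K -> (qpi (@boundaries k _ L) \o cycle_push) z = 0.
Proof.
move=> /asboolP[c cK zc]; apply/qpi_eq0/asboolP.
by exists (push k f c); [exact: push_chains cK|rewrite /= zc push_bd].
Qed.

Definition homology_map : {linear homology k K -> homology k L} :=
  qlift boundary_push.

Lemma homology_mapE z :
  homology_map (qpi (@boundaries k _ K) z) =
  qpi (@boundaries k _ L) (cycle_push z).
Proof. exact: (qliftE boundary_push). Qed.

End HomologyMap.

Lemma push_id (k : fieldType) (X : choiceType) (c : ochain k X) :
  push k id c = c.
Proof.
by apply: (@ochain_ext k X _ (push k id) idfun) => s; rewrite pushE map_id.
Qed.

Lemma push_comp (k : fieldType) (X Y Z : choiceType) (f : X -> Y) (g : Y -> Z)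
    (c : ochain k X) : push k g (push k f c) = push k (g \o f) c.
Proof.
pose F : {linear ochain k X -> ochain k Z} := push k g \o push k f.
by apply: (@ochain_ext k X _ F) => s; rewrite /F /= !pushE map_comp.
Qed.

Lemma homology_map_incl (k : fieldType) (X Y : choiceType)
    (K K' : simplicial_complex X) (L L' : simplicial_complex Y) (f : X -> Y)
    (KK' : subcomplex K K') (LL' : subcomplex L L')
    (fKL : simplicial K L f) (fKL' : simplicial K' L' f) x :
  homology_incl k LL' (homology_map k fKL x) =
  homology_map k fKL' (homology_incl k KK' x).
Proof.
rewrite -[x]qpi_repr homology_mapE [LHS]homology_inclE homology_inclE.
by rewrite homology_mapE; congr (qpi _ _); exact: val_inj.
Qed.

Lemma homology_map_comp_incl (k : fieldType) (X Y : choiceType)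
    (K K' : simplicial_complex X) (L : simplicial_complex Y)
    (f : X -> Y) (g : Y -> X) (KK' : subcomplex K K')
    (fKL : simplicial K L f) (gLK' : simplicial L K' g) x :
  contiguous K K' id (g \o f) ->
  homology_map k gLK' (homology_map k fKL x) = homology_incl k KK' x.
Proof.
move=> fg; rewrite -[x]qpi_repr !homology_mapE homology_inclE.
apply/qpi_eq/asboolP; set z := repr x.
have [c cL cE] := contiguous_homologous fg (valP z).
by exists c => //; rewrite -cE push_id -push_comp.
Qed.

(** * Cech complexes and almost isometric maps *)

Section CechCorrespondence.
Context (R : realType) (k : fieldType).

Section OneSided.
Context (X Y : metricType R) (eps : R) (f : X -> Y).
Hypothesis f_eps : forall x x', mdist (f x) (f x') <= mdist x x' + eps.

(** The image of a centre of a simplex is a centre of its image. *)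
Lemma cech_simplicial a : simplicial (cech X a) (cech Y (a + eps)) f.
Proof.
move=> s [s0 [z sz]]; split.
  by have /fset0Pn[x xs] := s0; apply/fset0Pn; exists (f x); rewrite in_imfset.
exists (f z) => _ /imfsetP[x /= xs ->].
by rewrite /cball /= (le_trans (f_eps _ _)) // lerD2r; exact: sz.
Qed.

Lemma cech_map_natural a b (ab : a <= b) (ab' : a + eps <= b + eps) x :
  pm_map (persistent_homology k (cech_filtration Y)) ab'
    (homology_map k (@cech_simplicial a) x) =
  homology_map k (@cech_simplicial b)
    (pm_map (persistent_homology k (cech_filtration X)) ab x).
Proof. exact: homology_map_incl. Qed.

Definition cech_hom : pm_hom eps
    (persistent_homology k (cech_filtration X))
    (persistent_homology k (cech_filtration Y)) :=
  @PMHom R k eps (persistent_homology k (cech_filtration X))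
    (persistent_homology k (cech_filtration Y))
    (fun a => homology_map k (@cech_simplicial a)) cech_map_natural.

End OneSided.

Section Composite.
Context (X Y : metricType R) (eps : R) (e0 : 0 <= eps).
Context (f : X -> Y) (g : Y -> X).
Hypothesis f_eps : forall x x', mdist (f x) (f x') <= mdist x x' + eps.
Hypothesis g_eps : forall y y', mdist (g y) (g y') <= mdist y y' + eps.
Hypothesis gf_eps : forall y x, mdist (g y) x <= mdist y (f x) + eps.

(** A centre of a simplex is also a centre, at the larger scale, of its image
under [g \o f]. *)
Lemma cech_contiguous a :
  contiguous (cech X a) (cech X (a + eps + eps)) id (g \o f).
Proof.
move=> s [s0 [z sz]]; split.
  by have /fset0Pn[x xs] := s0; apply/fset0Pn; exists x; rewrite inE in_imfset.
exists z => y /=; rewrite /cball /= inE => /orP[] /imfsetP[x /= xs ->].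
  by rewrite (le_trans (sz x xs)) // ler_shift2.
rewrite (le_trans (gf_eps _ _)) // lerD2r (le_trans (f_eps _ _)) // lerD2r.
exact: sz.
Qed.

Lemma cech_hom_comp a x :
  cech_hom g_eps (a + eps) (cech_hom f_eps a x) =
  pm_map (persistent_homology k (cech_filtration X)) (ler_shift2 e0 a) x.
Proof. exact/homology_map_comp_incl/cech_contiguous. Qed.

End Composite.

End CechCorrespondence.

(** * Correspondences of small distortion *)

Section Selections.
Context (R : realType) (X Y : metricType R).

(** Doubling cancels the factor one half, and an infimum below [eps] is
undercut by a member.  Distortions are nonnegative, even that of the empty
correspondence between empty spaces, whence [0 <= eps]. *)
Lemma correspondence_of_gromov_hausdorff (eps : R) :
  (2%:E * gromov_hausdorff X Y < eps%:E)%E ->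
  exists C : set (X * Y), [/\ correspondence C, 0 <= eps &
    forall p q, C p -> C q -> `|mdist p.1 q.1 - mdist p.2 q.2| <= eps].
Proof.
rewrite /gromov_hausdorff muleA -EFinM divff ?pnatr_eq0 // mul1e.
move=> /ereal_inf_lt[_ [C CXY <-]]; rewrite /distortion gt_max => /andP[e0 dC].
exists C; split=> //; first by move: e0; rewrite lte_fin => /ltW.
move=> p q Cp Cq; rewrite -lee_fin; apply: le_trans (ltW dC).
by apply: ereal_sup_ubound; exists p => //; exists q.
Qed.

Lemma correspondence_selections (C : set (X * Y)) : correspondence C ->
  exists (f : X -> Y) (g : Y -> X),
    (forall x, C (x, f x)) /\ (forall y, C (g y, y)).
Proof.
move=> [CX CY].
have /choice[f fC] x : exists y, C (x, y).
  have : [set: X] x by [].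
  by rewrite -CX => -[[x' y] Cxy /= <-]; exists y.
have /choice[g gC] y : exists x, C (x, y).
  have : [set: Y] y by [].
  by rewrite -CY => -[[x y'] Cxy /= <-]; exists x.
by exists f, g.
Qed.

End Selections.

Theorem lemma4p4 (R : realType) (k : fieldType) (X Y : metricType R) (eps : R)
  (heps : (2%:E * gromov_hausdorff X Y < eps%:E)%E) :
  interleaved eps (persistent_homology k (cech_filtration X))
                  (persistent_homology k (cech_filtration Y)).
Proof.
have [C [CXY e0 dC]] := correspondence_of_gromov_hausdorff heps.
have [f [g [fC gC]]] := correspondence_selections CXY.
have dCr p q : C p -> C q -> mdist p.2 q.2 <= mdist p.1 q.1 + eps.
  move=> Cp Cq; have := dC _ _ Cp Cq.
  by rewrite ler_distl => /andP[]; rewrite lerBlDr.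
have dCl p q : C p -> C q -> mdist p.1 q.1 <= mdist p.2 q.2 + eps.
  by move=> Cp Cq; have := dC _ _ Cp Cq; rewrite ler_distl => /andP[].
have f_eps x x' : mdist (f x) (f x') <= mdist x x' + eps.
  exact: (dCr _ _ (fC x) (fC x')).
have g_eps y y' : mdist (g y) (g y') <= mdist y y' + eps.
  exact: (dCl _ _ (gC y) (gC y')).
exists e0, (cech_hom k f_eps), (cech_hom k g_eps); split=> a x.
  by apply: cech_hom_comp => y x'; exact: (dCl _ _ (gC y) (fC x')).
by apply: cech_hom_comp => x' y; exact: (dCr _ _ (fC x') (gC y)).
Qed.
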